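(* Let $n\in\mathbb{N}$, let $X$ be an $n\times n$ random matrix, let $\mu_n=\frac1n\sum_{j=1}^n\delta_{\lambda_j(X/\sqrt n)}$ be the empirical spectral distribution of $X/\sqrt n$, and let $\mu_\infty$ be the uniform distribution on the unit disk. Then for all $p\ge1$ (and every realization of $X$) $$W_p(\mu_n,\mu_\infty)\ge\frac{1}{3\sqrt n}.$$
   Context: $\lambda_1(A),\dots,\lambda_n(A)$ denote the (complex) eigenvalues of an $n\times n$ matrix $A$, counted with algebraic multiplicity, and $\delta_\lambda$ is the Dirac measure at $\lambda$. The matrix $X$ has real or complex entries. $\mu_\infty$ is the probability measure on $\mathbb{C}$ with Lebesgue density $\frac1\pi\mathbf{1}_{B_1(0)}$, where $B_1(0)$ is the unit disk. For $1\le p<\infty$ and probability measures $\mu,\nu$ on $\mathbb{C}$, $W_p(\mu,\nu)=\big(\inf_{q\in\pi(\mu,\nu)}\int_{\mathbb{C}\times\mathbb{C}}|x-y|^p\,dq(x,y)\big)^{1/p}$, where $\pi(\mu,\nu)$ is the set of all couplings of $\mu$ and $\nu$, i.e. probability measures on $\mathbb{C}^2$ with marginals $\mu$ and $\nu$. *)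

(* Defs.v *)
From HB Require Import structures.
From mathcomp Require Import all_boot all_order all_algebra.
From mathcomp Require Import complex.
From mathcomp Require Import all_classical all_reals all_analysis measurable_realfun.

Set Implicit Arguments.
Unset Strict Implicit.
Unset Printing Implicit Defensive.

Import Order.TTheory GRing.Theory Num.Theory.
Import ComplexField.Normc.
Import numFieldNormedType.Exports.

Local Open Scope classical_set_scope.
Local Open Scope ring_scope.
Local Open Scope complex_scope.

(* R[i] is identified with the plane R * R: its measurable sets are the Borel
   sets of the plane and [lebesgue_complex] is the planar Lebesgue measure. *)
HB.instance Definition _ (R : realType) := isPointed.Build R[i] (0 +i* 0).

Section complex_measurable.
Context (R : realType).

Definition pair_of_complex (z : R[i]) : R * R := (complex.Re z, complex.Im z).
Definition complex_of_pair (xy : R * R) : R[i] := xy.1 +i* xy.2.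

Definition complex_measurable : set (set R[i]) :=
  preimage_set_system [set: R[i]] pair_of_complex measurable.

Let sac : sigma_algebra [set: R[i]] complex_measurable.
Proof. exact/sigma_algebra_preimage/sigma_algebra_measurable. Qed.

Let cm0 : complex_measurable set0.
Proof. by case: sac. Qed.

Let cmC A : complex_measurable A -> complex_measurable (~` A).
Proof. by rewrite -setTD; case: sac => _ + _; exact. Qed.

Let cmU (F : (set R[i])^nat) :
  (forall i, complex_measurable (F i)) -> complex_measurable (\bigcup_i F i).
Proof. by case: sac => _ _; exact. Qed.

Fact complex_display : measure_display.
Proof. exact: default_measure_display. Qed.

HB.instance Definition _ :=
  isMeasurable.Build complex_display R[i] cm0 cmC cmU.

Lemma measurable_pair_of_complex : measurable_fun setT pair_of_complex.
Proof. by move=> _ A mA; exists A. Qed.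

Lemma measurable_complex_of_pair : measurable_fun setT complex_of_pair.
Proof.
move=> _ _ [A mA <-]; rewrite !setTI.
suff -> : complex_of_pair @^-1` (pair_of_complex @^-1` A) = A by [].
by apply/seteqP; split=> -[x y].
Qed.

End complex_measurable.

Section disk_area.
Context {R : realType}.
Local Open Scope ereal_scope.
Notation mu := (@lebesgue_measure R).

Definition disk2 : set (R * R) := [set z | (z.1 ^+ 2 + z.2 ^+ 2 < 1)%R].

Lemma measurable_disk2 : measurable disk2.
Proof.
rewrite -[X in measurable X]setTI.
have mf : measurable_fun setT (fun z : R * R => z.1 ^+ 2 + z.2 ^+ 2)%R.
  apply: measurable_funD; apply: measurable_funX;
  [exact: measurable_fst|exact: measurable_snd].
rewrite (_ : disk2 = (fun z : R * R => z.1 ^+ 2 + z.2 ^+ 2)%R @^-1` `]-oo, 1%R[%classic).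
  exact: mf.
by apply/seteqP; split=> z; rewrite /= in_itv.
Qed.

Lemma disk2_xsection (x : R) :
  xsection disk2 x = `](- Num.sqrt (1 - x ^+ 2))%R, (Num.sqrt (1 - x ^+ 2))%R[%classic.
Proof.
apply/seteqP; split=> y; rewrite /xsection/= in_itv/= inE /disk2/=.
  move=> h; have x1 : (y ^+ 2 < 1 - x ^+ 2)%R by rewrite ltrBrDl.
  by rewrite -ltr_norml -sqrtr_sqr ltr_sqrt// (le_lt_trans _ x1)// sqr_ge0.
rewrite -ltr_norml -sqrtr_sqr => h; rewrite -ltrBrDl.
have : (0 < 1 - x ^+ 2)%R.
  by rewrite -sqrtr_gt0 (le_lt_trans _ h)// sqrtr_ge0.
by move=> /ltr_sqrt <-.
Qed.

Lemma area_integrand : forall x : R,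
  mu (xsection disk2 x) = (2 * Num.sqrt (1 - x ^+ 2))%:E.
Proof.
move=> x; rewrite disk2_xsection lebesgue_measure_itv/= lte_fin.
have := sqrtr_ge0 (1 - x ^+ 2); set s := Num.sqrt _.
rewrite le_eqVlt => /predU1P[<-|s0].
  by rewrite oppr0 ltxx mulr0.
by rewrite (lt_trans _ s0) ?oppr_lt0// -EFinB opprK mulr_natl mulr2n.
Qed.

Lemma area_disk2 : (mu \x mu) disk2 = pi%:E.
Proof.
rewrite /product_measure1 /=.
under eq_integral do rewrite area_integrand.
rewrite (_ : (fun x => _) = ((fun x : R => (2 * Num.sqrt (1 - x ^+ 2))%:E) \_ `[(-1)%R, 1%R]%classic)); last first.
  apply/funext => x; rewrite /patch; case: ifPn => //.
  rewrite notin_setE/= in_itv/= -ler_norml => /negP; rewrite -ltNge => x1.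
  rewrite ler0_sqrtr ?mulr0// subr_le0 -real_normK ?num_real//.
  by rewrite exprn_ege1// ltW.
rewrite -integral_mkcond.
have pi2 : (- (pi / 2) <= pi / 2 :> R)%R.
  by rewrite (@le_trans _ _ 0%R) ?oppr_le0// divr_ge0// pi_ge0.
pose G (x : R) := (2 * Num.sqrt (1 - x ^+ 2))%R.
have Dsin : derive1 (@sin R) = cos.
  by apply/funext => x; rewrite derive1E; exact: derive_val.
have ccos : continuous (@cos R) by exact: continuous_cos.
have lr (f : R -> R) : continuous f ->
    derivable_oo_LRcontinuous f (- (pi / 2))%R (pi / 2)%R <->
    {in `](- (pi / 2))%R, (pi / 2)%R[, forall x, derivable f x 1}.
  move=> cf; split=> [[]//|df]; split => //.
    exact/cvg_at_right_filter/cf.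
  exact/cvg_at_left_filter/cf.
have := @integration_by_substitution_increasing R sin G _ _ pi2.
rewrite sinN sin_pihalf => ->; first last.
- apply: continuous_subspaceT => x; rewrite /G.
  apply: cvgMr; apply: (@continuous_comp _ _ _ (fun x : R => 1 - x ^+ 2)%R Num.sqrt).
    by apply: cvgB; [exact: cvg_cst|exact: exprn_continuous].
  exact: sqrt_continuous.
- apply/lr; first exact: continuous_sin.
  by move=> x _; exact: derivable_sin.
- rewrite Dsin; apply/cvg_ex; exists (cos (pi / 2)%R).
  exact/cvg_at_left_filter/ccos.
- rewrite Dsin; apply/cvg_ex; exists (cos (- (pi / 2))%R).
  exact/cvg_at_right_filter/ccos.
- by rewrite Dsin => x _; exact: ccos.
- by move=> x y xI yI; rewrite ltr_sin.
have -> : \int[mu]_(x in `[(- (pi / 2))%R, (pi / 2)%R])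
    (((G \o sin) * derive1 sin)%R x)%:E =
   \int[mu]_(x in `[(- (pi / 2))%R, (pi / 2)%R]) (2 * cos x ^+ 2)%:E.
  apply: eq_integral => x; rewrite inE/= in_itv/= => xI; rewrite Dsin/=.
  congr EFin; rewrite /G /= [LHS](_ : _ = 2 * Num.sqrt (1 - sin x ^+ 2) * cos x)%R//.
  by rewrite -cos2sin2 sqrtr_sqr ger0_norm ?cos_ge0_pihalf// -mulrA -expr2.
have cF : continuous (fun x : R => x + sin x * cos x)%R.
  move=> x; apply: cvgD; first exact: cvg_id.
  by apply: cvgM; [exact: continuous_sin|exact: ccos].
rewrite (@continuous_FTC2 _ (fun x => 2 * cos x ^+ 2)%R (fun x => x + sin x * cos x)%R).
- rewrite sinN cosN cos_pihalf !mulr0 !addr0 -EFinB opprK; congr EFin.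
  by rewrite -splitr.
- by rewrite (@lt_trans _ _ 0%R) ?oppr_lt0 ?divr_gt0 ?pi_gt0.
- apply: continuous_subspaceT => x.
  apply: cvgMr; apply: (@continuous_comp _ _ _ cos (fun x : R => x ^+ 2)%R).
    exact: ccos.
  exact: exprn_continuous.
- by apply/lr => // x _; apply: derivableD => //; exact: derivableM.
- move=> x _; rewrite derive1E.
  have /@derive_val -> : is_derive x (1%R : R) (fun x : R => x + sin x * cos x)%R
     (1 + (sin x *: - sin x + cos x *: cos x))%R.
    by apply: is_deriveD; apply: is_deriveM.
  rewrite /GRing.scale/= mulrN -!expr2 sin2cos2 opprB.
  by rewrite addrA addrCA subrr addr0 mulr_natl mulr2n.
Qed.
End disk_area.

Section circular_law.
Context (R : realType).
Local Open Scope ereal_scope.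
Notation leb2 := ((@lebesgue_measure R) \x (@lebesgue_measure R)).

Definition lebesgue_complex : set R[i] -> \bar R :=
  pushforward leb2 (@complex_of_pair R).

Let leb0 : lebesgue_complex set0 = 0.
Proof. by rewrite /lebesgue_complex /pushforward preimage_set0 measure0. Qed.

Let leb_ge0 A : 0 <= lebesgue_complex A.
Proof. by rewrite /lebesgue_complex /pushforward measure_ge0. Qed.

Let leb_sigma_additive : semi_sigma_additive lebesgue_complex.
Proof.
have mp A : measurable A -> measurable (@complex_of_pair R @^-1` A).
  move=> mA; rewrite -[X in measurable X]setTI.
  exact: measurable_complex_of_pair.
move=> F mF tF mUF; rewrite /lebesgue_complex /pushforward preimage_bigcup.
apply: measure_semi_sigma_additive.
- by move=> n; exact: mp.
- apply/trivIsetP => /= i j _ _ ij; rewrite -preimage_setI.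
  by move/trivIsetP : tF => /(_ _ _ _ _ ij) ->//; rewrite preimage_set0.
- by rewrite -preimage_bigcup; exact: mp.
Qed.

HB.instance Definition _ := isMeasure.Build _ _ _ lebesgue_complex
  leb0 leb_ge0 leb_sigma_additive.

Definition unit_disk : set R[i] := [set z | (normc z < 1)%R].

Definition circular_pdf (z : R[i]) : R := (pi^-1 * \1_unit_disk z)%R.

Definition circular_law (U : set R[i]) : \bar R :=
  \int[lebesgue_complex]_(z in U) (circular_pdf z)%:E.

Lemma preimage_unit_disk : @complex_of_pair R @^-1` unit_disk = disk2.
Proof.
apply/seteqP; split=> -[x y]; rewrite /unit_disk /disk2 /= => h.
  by rewrite -ltr_sqrt// sqrtr1.
by rewrite -[ltRHS]sqrtr1 ltr_sqrt.
Qed.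

Lemma measurable_unit_disk : measurable unit_disk.
Proof.
exists disk2; first exact: measurable_disk2.
by rewrite setTI -preimage_unit_disk; apply/seteqP; split=> -[x y].
Qed.

Lemma lebesgue_complex_unit_disk : lebesgue_complex unit_disk = pi%:E.
Proof. by rewrite /lebesgue_complex /pushforward preimage_unit_disk area_disk2. Qed.

Lemma circular_pdf_ge0 z : (0 <= circular_pdf z)%R.
Proof. by rewrite mulr_ge0// invr_ge0 pi_ge0. Qed.

Lemma measurable_circular_pdf : measurable_fun setT circular_pdf.
Proof.
apply: measurable_funM; first exact: measurable_cst.
by apply: measurable_indic; exact: measurable_unit_disk.
Qed.

Let circular0 : circular_law set0 = 0.
Proof. by rewrite /circular_law integral_set0. Qed.

Let circular_ge0 U : 0 <= circular_law U.
Proof. by apply: integral_ge0 => z _; rewrite lee_fin circular_pdf_ge0. Qed.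

Let circular_sigma_additive : semi_sigma_additive circular_law.
Proof.
move=> F mF tF mUF; rewrite /circular_law; apply: cvg_toP.
  apply: ereal_nondecreasing_is_cvgn => m n mn.
  by apply: lee_sum_nneg_natr => // k _ _; exact: circular_ge0.
rewrite ge0_integral_bigcup//=.
- apply: measurable_funTS; apply: measurableT_comp => //.
  exact: measurable_circular_pdf.
- by move=> z _; rewrite lee_fin circular_pdf_ge0.
Qed.

HB.instance Definition _ := isMeasure.Build _ _ _ circular_law
  circular0 circular_ge0 circular_sigma_additive.

Let circular_setT : circular_law setT = 1.
Proof.
rewrite /circular_law; under eq_integral do rewrite EFinM.
have mD : measurable_fun setT (fun z : R[i] => (\1_unit_disk z)%:E : \bar R).
  by apply/measurable_EFinP; apply: measurable_indic; exact: measurable_unit_disk.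
rewrite ge0_integralZl_EFin ?invr_ge0 ?pi_ge0//.
rewrite integral_indic//; last exact: measurable_unit_disk.
rewrite setIT [X in _ * X]lebesgue_complex_unit_disk.
by rewrite -EFinM mulVf// gt_eqF// pi_gt0.
Qed.

HB.instance Definition _ :=
  @Measure_isProbability.Build _ _ R circular_law circular_setT.

End circular_law.
Arguments lebesgue_complex : clear implicits.
Arguments unit_disk : clear implicits.
Arguments circular_law : clear implicits.

Section empirical_spectral_distribution.
Context (R : realType) (n : nat).
Local Open Scope ereal_scope.

(* [char_poly_eigenvalues] below shows that each root of the characteristic
   polynomial is listed with its algebraic multiplicity. *)
Definition eigenvalues (A : 'M[R[i]]_n) : seq R[i] :=
  sval (closed_field_poly_normal (char_poly A)).

Lemma char_poly_eigenvalues (A : 'M[R[i]]_n) :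
  char_poly A = (\prod_(z <- eigenvalues A) ('X - z%:P))%R.
Proof.
rewrite /eigenvalues; case: closed_field_poly_normal => r /= {1}->.
by rewrite (monicP (char_poly_monic A)) scale1r.
Qed.

Lemma size_eigenvalues (A : 'M[R[i]]_n) : size (eigenvalues A) = n.
Proof.
apply: succn_inj; rewrite -(size_char_poly A) char_poly_eigenvalues.
by rewrite size_prod_XsubC.
Qed.

(* [n_gt0] is not used by the formula; it makes [esd] a probability. *)
Definition esd (n_gt0 : (0 < n)%N) (A : 'M[R[i]]_n) (U : set R[i]) : \bar R :=
  (n%:R^-1)%:E * \sum_(j < n) \d_((eigenvalues A)`_j) U.

Context (n_gt0 : (0 < n)%N) (A : 'M[R[i]]_n).

Let esd_mscale : esd n_gt0 A =
  mscale ((n%:R : R)^-1)%:nng%R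
    (msum (fun j => \d_((eigenvalues A)`_j) : {measure set R[i] -> \bar R}) n).
Proof. by []. Qed.

Let esd0 : esd n_gt0 A set0 = 0.
Proof. by rewrite esd_mscale measure0. Qed.

Let esd_ge0 U : 0 <= esd n_gt0 A U.
Proof. by rewrite esd_mscale measure_ge0. Qed.

Let esd_sigma_additive : semi_sigma_additive (esd n_gt0 A).
Proof. by rewrite esd_mscale; exact: measure_semi_sigma_additive. Qed.

HB.instance Definition _ := isMeasure.Build _ _ _ (esd n_gt0 A)
  esd0 esd_ge0 esd_sigma_additive.

Let esd_setT : esd n_gt0 A setT = 1.
Proof.
rewrite /esd; under eq_bigr do rewrite diracT.
by rewrite sumEFin sumr_const card_ord -EFinM mulVf// pnatr_eq0 -lt0n.
Qed.

HB.instance Definition _ :=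
  @Measure_isProbability.Build _ _ R (esd n_gt0 A) esd_setT.

End empirical_spectral_distribution.

Section wasserstein.
Context (R : realType).
Local Open Scope ereal_scope.

Definition couplings (mu nu : probability R[i] R) :
    set (probability (R[i] * R[i])%type R) :=
  [set q | (forall U, measurable U -> q (U `*` setT) = mu U) /\
           (forall U, measurable U -> q (setT `*` U) = nu U)].

(* The value lies in [\bar R]: it is [+oo] when the transport cost is. *)
Definition wasserstein (p : R) (mu nu : probability R[i] R) : \bar R :=
  (ereal_inf [set \int[q]_z ((normc (z.1 - z.2)%R) `^ p)%:E
             | q in couplings mu nu]) `^ p^-1.

End wasserstein.

(* Main.v *)
Require Import Defs.
From HB Require Import structures.
From mathcomp Require Import all_boot all_order all_algebra.
From mathcomp Require Import complex.
From mathcomp Require Import all_classical all_reals all_analysis.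
From mathcomp Require Import measurable_realfun ring lra.

(** Optimal transport cannot bring the uniform distribution on the disk closer
    to a measure carried by few points than the scale at which those points
    fill the disk.

    Let [mu] be carried by [n] points.  Whatever the coupling [q] of [mu] and
    the circular law, [q]-almost every pair [(x, y)] with [|x - y| < r] has [y]
    in one of the [n] squares of half-side [r] centred at the points.  Each
    such square has area [4 r^2], hence circular mass at most
    [4 r^2 / pi <= (4 / 3) r^2] because [pi >= 3] ([circular_law_square]), so
    [q] gives mass at least [1 - (4 / 3) n r^2] to the pairs at distance at
    least [r] ([coupling_dist_ge]).  Markov's inequality turns a mass [c] of
    pairs at distance at least [r] into the bound
    [W_p >= r c^(1/p) >= r c], uniformly in [p >= 1] ([wasserstein_ge]).  With
    [r = 1 / (2 sqrt n)] the mass is [2 / 3], and [r c = 1 / (3 sqrt n)].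

    Squares are used instead of disks because their area is that of a product
    of intervals; the constant [1 / 3] leaves exactly the room for this
    together with [pi >= 3].  The empirical spectral distribution is carried
    by its [n] eigenvalues whatever the matrix is, so the bound holds for every
    realization of [X]. *)

Set Implicit Arguments.
Unset Strict Implicit.
Unset Printing Implicit Defensive.

Import Order.TTheory GRing.Theory Num.Theory.
Import numFieldNormedType.Exports.

Local Open Scope classical_set_scope.
Local Open Scope ring_scope.
Local Open Scope complex_scope.

Local Notation normc := ComplexField.Normc.normc.

(** * The bound 3 <= pi *)

Lemma sin_le_id (R : realType) (x : R) : 0 <= x -> sin x <= x.
Proof.
move=> x0; have csin : {within `[0, x], continuous (@sin R)}.
  by apply: continuous_subspaceT; exact: continuous_sin.
have [c _] := MVT_segment x0 (fun y _ => is_derive_sin y) csin.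
by rewrite sin0 !subr0 => ->; rewrite ler_piMl// cos_le1.
Qed.

(** With [x = pi / 6] and [s = sin x], the triple angle formula
    [sin (3 x) = 3 s - 4 s^3] applied to [sin (pi / 2) = 1] reads [(s + 1) (2 s - 1)^2 = 0], and [s > 0]
    leaves a single root. *)
Lemma sin_pi6 (R : realType) : sin (pi / 6 : R) = 1 / 2.
Proof.
set x : R := pi / 6; have pi0 := pi_gt0 R.
have s0 : 0 < sin x by apply: sin_gt0_pi; rewrite /x; lra.
have : sin (x *+ 2 + x) = 1.
  rewrite -[RHS](sin_pihalf R); congr sin.
  by rewrite /x -mulr_natl; field.
rewrite sinD sin_mulr2n cos_mulr2n.
set s := sin x in s0 *; set c := cos x => h.
have c2 : c ^+ 2 = 1 - s ^+ 2 by exact: cos2sin2.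
have {h} : (s + 1) * (2 * s - 1) ^+ 2 = 0.
  have {}h : 2 * c ^+ 2 * s + (2 * c ^+ 2 - 1) * s = 1.
    by apply: etrans h; ring.
  rewrite c2 in h.
  have -> : (s + 1) * (2 * s - 1) ^+ 2 =
    1 - (2 * (1 - s ^+ 2) * s + (2 * (1 - s ^+ 2) - 1) * s) by ring.
  by rewrite h subrr.
move/eqP; rewrite mulf_eq0 sqrf_eq0 => /orP[|]/eqP; lra.
Qed.

(** The arc [pi / 6] is longer than its sine [1 / 2]. *)
Lemma pi_ge3 (R : realType) : 3 <= pi :> R.
Proof.
have pi0 := pi_gt0 R; have := @sin_le_id R (pi / 6); rewrite sin_pi6; lra.
Qed.

Section circular_law_quantization.
Context (R : realType).
Local Open Scope ereal_scope.

(** * Borel sets of the complex plane *)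

Lemma measurable_Re : measurable_fun setT (@complex.Re R).
Proof.
by have /(measurableT_comp measurable_fst) := @measurable_pair_of_complex R.
Qed.

Lemma measurable_Im : measurable_fun setT (@complex.Im R).
Proof.
by have /(measurableT_comp measurable_snd) := @measurable_pair_of_complex R.
Qed.

Lemma measurable_complex_set1 (c : R[i]) : measurable [set c].
Proof.
exists ([set complex.Re c] `*` [set complex.Im c]).
  by apply: measurableX; exact: measurable_set1.
by apply/seteqP; split=> [[a b]|_ ->//]; case: c => u v /= [_ []] /= -> ->.
Qed.

Lemma measurable_complex_seq (s : seq R[i]) : measurable [set` s].
Proof.
elim: s => [|c s ih]; first by rewrite set_nil.
rewrite (_ : [set` c :: s] = [set c] `|` [set` s]); last first.
  apply/seteqP; split=> z /=; rewrite inE; first by case/predU1P; [left|right].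
  by case=> [->|->]; rewrite ?eqxx ?orbT.
apply: measurableU => //; exact: measurable_complex_set1.
Qed.

Lemma measurable_dist :
  measurable_fun setT (fun z : R[i] * R[i] => normc (z.1 - z.2)%R).
Proof.
have -> : (fun z : R[i] * R[i] => normc (z.1 - z.2)%R) =
    Num.sqrt \o (fun z : R[i] * R[i] => (complex.Re z.1 - complex.Re z.2) ^+ 2 +
                       (complex.Im z.1 - complex.Im z.2) ^+ 2)%R.
  by apply/funext => -[[a b] [c d]].
apply: measurableT_comp.
  by apply: continuous_measurable_fun; exact: sqrt_continuous.
apply: measurable_funD; apply: measurable_funX; apply: measurable_funB.
- exact: measurableT_comp measurable_Re measurable_fst.
- exact: measurableT_comp measurable_Re measurable_snd.
- exact: measurableT_comp measurable_Im measurable_fst.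
- exact: measurableT_comp measurable_Im measurable_snd.
Qed.

Lemma measurable_dist_ge (r : R) :
  measurable [set z : R[i] * R[i] |
    (r <= normc (z.1 - z.2))%R].
Proof.
rewrite -[X in measurable X]setTI.
rewrite (_ : mkset _ =
    (fun z : R[i] * R[i] => normc (z.1 - z.2)%R)
    @^-1` `[r, +oo[%classic); first exact: measurable_dist.
by apply/seteqP; split => z /=; rewrite in_itv /= andbT.
Qed.

(** * Circular mass of a square *)

(** This is the open ball of radius [r] for the sup norm of the real and
    imaginary parts. *)
Definition square (c : R[i]) (r : R) : set R[i] :=
  @pair_of_complex R @^-1`
    (`](complex.Re c - r)%R, (complex.Re c + r)%R[%classic `*`
     `](complex.Im c - r)%R, (complex.Im c + r)%R[%classic).

Lemma measurable_square c r : measurable (square c r).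
Proof.
rewrite -[X in measurable X]setTI.
by apply: measurable_pair_of_complex => //; exact: measurableX.
Qed.

Lemma normc_lt_square (c z : R[i]) (r : R) :
  (normc (c - z) < r)%R -> square c r z.
Proof.
case: c z => [a b] [x y] /= h; rewrite /square /= !in_itv /=.
set u := (a - x)%R in h; set v := (b - y)%R in h.
have lr (t t' : R) : (Num.sqrt (t ^+ 2 + t' ^+ 2) < r -> `|t| < r)%R.
  apply: le_lt_trans; rewrite -sqrtr_sqr ler_sqrt ?lerDl ?addr_ge0 ?sqr_ge0//.
have := lr _ _ h; rewrite addrC in h; have := lr _ _ h.
by rewrite !ltr_norml /u /v => /andP[? ?] /andP[? ?]; split; apply/andP; split; lra.
Qed.

Lemma lebesgue_complex_square (c : R[i]) (r : R) : (0 <= r)%R ->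
  lebesgue_complex R (square c r) = (4 * r ^+ 2)%:E.
Proof.
move=> r0; rewrite /lebesgue_complex /pushforward.
rewrite [X in (_ \x _) X](_ : _ =
    `](complex.Re c - r)%R, (complex.Re c + r)%R[%classic `*`
     `](complex.Im c - r)%R, (complex.Im c + r)%R[%classic); last first.
  by apply/seteqP; split => -[x y].
rewrite product_measure1E//.
have side (a : R) :
    lebesgue_measure (`](a - r)%R, (a + r)%R[%classic : set R) = (2 * r)%:E.
  rewrite lebesgue_measure_itv /= lte_fin; case: ltP => h.
    by rewrite -EFinB; congr EFin; ring.
  by congr EFin; lra.
by rewrite [X in X * _]side [X in _ * X]side -EFinM; congr EFin; ring.
Qed.

Lemma circular_law_le_lebesgue (U : set R[i]) : measurable U ->
  circular_law R U <= (pi^-1)%:E * lebesgue_complex R U.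
Proof.
move=> mU; rewrite /circular_law -integral_cst//.
apply: ge0_le_integral => //.
- by move=> z _; rewrite lee_fin circular_pdf_ge0.
- by apply/measurable_funTS/measurable_EFinP; exact: measurable_circular_pdf.
- move=> z _; rewrite lee_fin /circular_pdf ler_piMr ?invr_ge0 ?pi_ge0//.
Qed.

(** The area is [4 r^2] and the density at most [1 / pi <= 1 / 3]. *)
Lemma circular_law_square (c : R[i]) (r : R) : (0 <= r)%R ->
  circular_law R (square c r) <= (4 / 3 * r ^+ 2)%:E.
Proof.
move=> r0; apply: le_trans (circular_law_le_lebesgue (measurable_square c r)) _.
rewrite [X in _ * X]lebesgue_complex_square// -EFinM lee_fin mulrA.
apply: ler_wpM2r; first exact: sqr_ge0.
by rewrite mulrC ler_pM2l// lef_pV2 ?posrE ?pi_gt0// pi_ge3.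
Qed.

(** * Lower bounds on the transport cost *)

(** Markov's inequality bounds every transport cost below by [r^p c]; taking
    the [p]-th root leaves [r c^(1/p)], which is at least [r c] as [c <= 1].
    Hence a bound that does not depend on [p]. *)
Lemma wasserstein_ge (mu nu : probability R[i] R) (p r c : R) :
  (1 <= p)%R -> (0 <= r)%R -> (0 < c <= 1)%R ->
  (forall q, couplings mu nu q ->
     c%:E <= q [set z | (r <= normc (z.1 - z.2))%R]) ->
  (r * c)%:E <= wasserstein p mu nu.
Proof.
move=> p1 r0 /andP[c0 c1] far.
have p0 : (0 < p)%R by exact: lt_le_trans p1.
have cost : (r `^ p * c)%:E <= ereal_inf
    [set \int[q]_z ((normc (z.1 - z.2)%R) `^ p)%:E
     | q in couplings mu nu].
  apply: le_ereal_inf_tmp => _ [q qmn <-].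
  pose E := [set z : R[i] * R[i] | (r <= normc (z.1 - z.2))%R].
  have mE : measurable E by exact: measurable_dist_ge.
  have mf : measurable_fun setT
      (fun z : R[i] * R[i] =>
         ((normc (z.1 - z.2)%R) `^ p)%:E : \bar R).
    apply/measurable_EFinP.
    exact: measurableT_comp (measurable_powR p) measurable_dist.
  apply: (@le_trans _ _ (\int[q]_(z in E) (cst (r `^ p)%:E z))).
    rewrite integral_cst// EFinM lee_wpmul2l ?lee_fin ?powR_ge0//.
    exact: far.
  apply: (@le_trans _ _
      (\int[q]_(z in E) ((normc (z.1 - z.2)%R) `^ p)%:E)).
    apply: ge0_le_integral => //.
    - by move=> z _; rewrite lee_fin powR_ge0.
    - exact: measurable_funTS.
    - move=> z Ez; rewrite lee_fin; apply: ge0_ler_powR => //.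
      + exact: ltW.
      + by rewrite nnegrE (le_trans r0).
  by apply: ge0_subset_integral => // z _; rewrite lee_fin powR_ge0.
rewrite /wasserstein.
have ip0 : (0 <= p^-1)%R by rewrite invr_ge0 ltW.
have rc0 : 0 <= (r `^ p * c)%:E by rewrite lee_fin mulr_ge0 ?powR_ge0 ?ltW.
apply: le_trans (gt0_ler_poweR ip0 _ _ cost); last first.
- by rewrite in_itv /= leey (le_trans rc0).
- by rewrite in_itv /= leey rc0.
rewrite poweR_EFin lee_fin powRM ?powR_ge0 ?(ltW c0)// -powRrM mulfV ?gt_eqF//.
rewrite powRr1//; apply: ler_wpM2l => //; rewrite -[leLHS](powRr1 (ltW c0)).
by apply: ger_powR; rewrite ?c0// invf_le1.
Qed.

(** A pair closer than [r] has its first point outside [s], which [q] does not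
    see, or its second point in the square around some point of [s]; the
    marginals of [q] evaluate both events. *)
Lemma coupling_dist_ge (mu nu : probability R[i] R) (s : seq R[i])
    (r m : R) q : mu (~` [set` s]) = 0 ->
  (forall c, c \in s -> nu (square c r) <= m%:E) ->
  couplings mu nu q ->
  (1 - (size s)%:R * m)%:E <=
    q [set z | (r <= normc (z.1 - z.2))%R].
Proof.
move=> mus nus [qmu qnu].
set F := [set z | _].
have mF : measurable F by exact: measurable_dist_ge.
pose S := \big[setU/set0]_(k < size s) square s`_k r.
have mS : measurable S by apply: bigsetU_measurable => k _; exact: measurable_square.
have nuS : nu S <= ((size s)%:R * m)%:E.
  apply: (@le_trans _ _ (\sum_(k < size s) nu (square s`_k r))).
    apply: (@content_subadditive _ _ _ nu S (fun k => square s`_k r) (size s)) => //.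
    by move=> k _; exact: measurable_square.
  rewrite mulr_natl -[X in (m *+ X)%R](card_ord (size s)) -sumr_const -sumEFin.
  by apply: lee_sum => k _; apply: nus; exact: mem_nth.
have near : ~` F `<=` (~` [set` s] `*` setT) `|` (setT `*` S).
  move=> [x y] /= /negP; rewrite -ltNge => xy.
  have [xs|xs] := boolP (x \in s); last by left; split => //=; apply/negP.
  right; split => //=.
  rewrite /S -(bigcup_mkord (size s) (fun k => square s`_k r)).
  exists (index x s) => /=.
    by rewrite index_mem.
  by rewrite nth_index//; exact: normc_lt_square.
have ms : measurable (~` [set` s]) by apply: measurableC; exact: measurable_complex_seq.
have qnear : q (~` F) <= ((size s)%:R * m)%:E.
  apply: (@le_trans _ _ (q ((~` [set` s] `*` setT) `|` (setT `*` S)))).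
    apply: le_measure => //; rewrite inE; first exact: measurableC.
    by apply: measurableU; exact: measurableX.
  apply: le_trans (measureU2 _ _ _) _; try exact: measurableX.
  by rewrite [X in X + _]qmu// [X in _ + X]qnu// mus add0e.
rewrite -[F]setCK probability_setC; last exact: measurableC.
by rewrite EFinB leeB.
Qed.

(** Up to the constant, this is the rate at which the best quantization by
    [size s] points approximates the uniform distribution on the disk: no
    choice of points and weights does better. *)
Lemma wasserstein_circular_law_ge (mu : probability R[i] R) (s : seq R[i]) (p : R) :
  (1 <= p)%R -> mu (~` [set` s]) = 0 ->
  (1 / (3 * Num.sqrt (size s)%:R))%:E <= wasserstein p mu (circular_law R).
Proof.
move=> p1 mus.
have n0 : (0 < size s)%N.
  case: s mus => // /eqP; rewrite set_nil setC0 probability_setT.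
  by rewrite onee_eq0.
set w := Num.sqrt _; have w0 : (0 < w)%R by rewrite sqrtr_gt0 ltr0n.
(* The radius [1 / (2 w)] maximizes [r (1 - 4 / 3 w^2 r^2)]. *)
have -> : (1 / (3 * w) = 1 / (2 * w) * (2 / 3))%R by field; rewrite gt_eqF.
have r0 : (0 <= 1 / (2 * w))%R by rewrite divr_ge0// mulr_ge0// ltW.
apply: wasserstein_ge => //; first lra.
move=> q qmn.
have -> : (2 / 3 = 1 - (size s)%:R * (4 / 3 * (1 / (2 * w)) ^+ 2) :> R)%R.
  rewrite -[in RHS](@sqr_sqrtr R (size s)%:R) ?ler0n// -/w.
  by field; rewrite gt_eqF.
apply: coupling_dist_ge mus _ qmn => c _.
exact: circular_law_square.
Qed.

Lemma esd_eigenvaluesC (n : nat) (n_gt0 : (0 < n)%N) (A : 'M[R[i]]_n) :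
  esd n_gt0 A (~` [set` eigenvalues A]) = 0.
Proof.
rewrite /esd big1 ?mule0// => j _; rewrite diracE memNset// => /= notin; apply: notin.
by apply: mem_nth; rewrite size_eigenvalues.
Qed.

End circular_law_quantization.

Theorem lemma5 (R : realType) (n : nat) (n_gt0 : (0 < n)%N)
    (d : measure_display) (Omega : measurableType d) (P : probability Omega R)
    (X : Omega -> 'M[R[i]]_n)
    (mX : forall i j : 'I_n, measurable_fun setT (fun w => X w i j)) :
  forall (w : Omega) (p : R), 1 <= p ->
    ((1 / (3 * Num.sqrt (n%:R : R)))%:E <=
     wasserstein p (esd n_gt0 (((Num.sqrt (n%:R : R))^-1)%:C *: X w))
                   (circular_law R))%E.
Proof.
move=> w p p1; set A := _ *: X w.
have := wasserstein_circular_law_ge p1 (esd_eigenvaluesC n_gt0 A).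
by rewrite size_eigenvalues.
Qed.
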